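(* Let $(M,\widetilde{\varepsilon})$ be a local Lie group. Then the linearization maps $L:\Lambda^k_{hor}(M\times M)\to T^*\otimes\Lambda^k$, $0\le k\le n$, make the following diagram commute: $$\begin{array}{ccccccc} \Lambda^0_{hor}(M\times M)&\xrightarrow{\widetilde{d}}&\Lambda^1_{hor}(M\times M)&\xrightarrow{\widetilde{d}}&\cdots&\xrightarrow{\widetilde{d}}&\Lambda^n_{hor}(M\times M)\\ \downarrow L&&\downarrow L&&\downarrow L&&\downarrow L\\ T^*=\Lambda^1&\xrightarrow{\widehat{d}}&T^*\otimes\Lambda^1&\xrightarrow{\widehat{d}}&\cdots&\xrightarrow{\widehat{d}}&T^*\otimes\Lambda^n \end{array}$$ i.e. $L\circ\widetilde{d}=\widehat{d}\circ L$.
   Context: All objects are smooth; $M$ is a connected manifold, $\dim M=n$. A splitting $\widetilde{\varepsilon}$ of $J_1(M\times M)\to M\times M$ assigns smoothly to each $(p,q)\in M\times M$ a 1-arrow (invertible 1-jet) from $p$ to $q$, i.e. a linear isomorphism $\widetilde{\varepsilon}(p,q):T_pM\to T_qM$ with coordinate matrix $\widetilde{\varepsilon}^i_j(x,y)$, compatible with composition and inversion: $\widetilde{\varepsilon}(q,r)\widetilde{\varepsilon}(p,q)=\widetilde{\varepsilon}(p,r)$, $\widetilde{\varepsilon}(q,p)=\widetilde{\varepsilon}(p,q)^{-1}$. $(M,\widetilde{\varepsilon})$ is a local Lie group if the integrability condition $\widetilde{\mathcal R}=0$ of the PDE $\partial f^i/\partial x^j=\widetilde{\varepsilon}^i_j(x,f(x))$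 holds identically on $M\times M$, i.e. $\frac{\partial\widetilde{\varepsilon}^a_r}{\partial x^s}+\frac{\partial\widetilde{\varepsilon}^a_r}{\partial y^b}\widetilde{\varepsilon}^b_s$ is symmetric in $r,s$; equivalently, for all $p,q$ the PDE has a (unique) local solution with $f(p)=q$. Define $\widetilde{\Gamma}^i_{kj}(x)=\left[\partial\widetilde{\varepsilon}^i_j(x,y)/\partial y^k\right]_{y=x}$ and $\widehat{\Gamma}^i_{jk}=\widetilde{\Gamma}^i_{kj}$. $\Lambda^k_{hor}(M\times M)$ is the space of nonlinear horizontal $k$-forms: smooth assignments to $(p,q)\in M\times M$ of an ordinary $k$-form at $p$, written $\omega_I(x,y)dx^I=\frac1{k!}\omega_{i_1\dots i_k}(x,y)dx^{i_1}\wedge\dots\wedge dx^{i_k}$ in coordinates $x$ around $p$, $y$ around $q$. $\widetilde{d}\omega=\left(\frac{\partial\omega_I}{\partial x^r}+\frac{\partial\omega_I}{\partial y^a}\widetilde{\varepsilon}^a_r(x,y)\right)dx^r\wedge dx^I$. $T^*\otimes\Lambda^k$ is the space of sections $\omega_{a,i_1\dots i_k}(x)$ of $T^*(M)\otimes\Lambda^k(M)\to M$, viewed as $k$-forms $\omega_{a,I}(x)\xi^a\,dx^I$ at $x$ depending linearly on a tangent vector $\xi$ at $x$. $\widehat{d}\omega=\left(\frac{\partial\omega_{a,I}}{\partial x^r}+\omega_{b,I}\widehat{\Gamma}^b_{ra}\right)\xi^a\,dx^r\wedge dx^I$. The linearization map $L$ is defined, using the same coordinate system for $x$ and for $y$ near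 $x$, by $$(L\omega)_I(x,\xi)=\left[\frac{d}{dt}\omega_I(x,x+t\xi)\right]_{t=0}=\left[\frac{\partial\omega_I(x,y)}{\partial y^a}\right]_{y=x}\xi^a .$$ *)

(* Defs.v *)
(* MathComp / MathComp-Analysis. *)
From HB Require Import structures.
From mathcomp Require Import all_boot all_order all_algebra all_fingroup.
From mathcomp Require Import boolp classical_sets functions reals.
From mathcomp Require Import topology tvs normedtype derive.

Set Implicit Arguments.
Unset Strict Implicit.
Unset Printing Implicit Defensive.

Import Order.TTheory GRing.Theory Num.Theory.
Import numFieldNormedType.Exports.

Local Open Scope classical_set_scope.
Local Open Scope ring_scope.

(* The conditions at order k constrain f at the points of U only, and are
   meaningful because U is always open below. *)
Fixpoint Ck (R : realType) (V W : normedModType R) (k : nat) (U : set V)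
    (f : V -> W) : Prop :=
  if k is k'.+1 then
    (forall x, U x -> differentiable f x) /\
    (forall v : V, Ck k' U (fun x => 'D_v f x))
  else forall x, U x -> {for x, continuous f}.

Definition smooth (R : realType) (V W : normedModType R) (U : set V)
    (f : V -> W) : Prop :=
  forall k, Ck k U f.

Definition pd (R : realType) (n : nat) (r : 'I_n) (f : 'rV[R]_n -> R)
    (x : 'rV[R]_n) : R :=
  'D_(delta_mx ord0 r) f x.

(* Entry (a, b) is d f^a / d x^b, so this is the transpose of the library's
   'J f x, whose convention is v *m 'J f x. *)
Definition jac (R : realType) (n : nat) (f : 'rV[R]_n -> 'rV[R]_n)
    (x : 'rV[R]_n) : 'M[R]_n :=
  \matrix_(a, b) pd b (fun u => f u ord0 a) x.

(* A smooth structure is given by an arbitrary (possibly maximal) smooth atlas.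
   [pnt c] is the inverse of the chart [crd c]; its values outside
   [crd c @` dom c] are irrelevant. *)
Record manifold (R : realType) (n : nat) (M : topologicalType) := Manifold {
  chart : Type ;
  dom : chart -> set M ;
  crd : chart -> M -> 'rV[R]_n ;
  pnt : chart -> 'rV[R]_n -> M ;
  cod := fun c : chart => crd c @` dom c ;
  overlap := fun c c' : chart => crd c @` (dom c `&` dom c') ;
  trans := fun c c' : chart => crd c' \o pnt c ;
  mfd_hausdorff : hausdorff_space M ;
  mfd_second_countable : @second_countable M ;
  dom_cover : forall p, exists c, dom c p ;
  dom_open : forall c, open (dom c) ;
  cod_open : forall c, open (cod c) ;
  crdK : forall c p, dom c p -> pnt c (crd c p) = p ;
  crd_continuous : forall c p, dom c p -> {for p, continuous (crd c)} ;
  pnt_continuous : forall c x, cod c x -> {for x, continuous (pnt c)} ;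
  trans_smooth : forall c c', smooth (overlap c c') (trans c c')
}.

Section NonlinearForms.
Context {R : realType} {n : nat} {M : topologicalType} (X : manifold R n M).

(* Geometric objects are given by their components in all charts (pairs of
   charts, for objects on M x M), subject to the transformation law; component
   functions are only relevant on the images of the charts. *)

(* [eps c d x y a r] is eps^a_r(x, y), with x in the chart c and y in d. *)
Definition ecomp : Type :=
  chart X -> chart X -> 'rV[R]_n -> 'rV[R]_n -> 'M[R]_n.

Record is_splitting (eps : ecomp) : Prop := IsSplitting {
  eps_smooth : forall c d a r,
    smooth (cod c `*` cod d) (fun z => eps c d z.1 z.2 a r) ;
  eps_change : forall c c' d d' x' y',
    overlap c' c x' -> overlap d' d y' ->
    let x := trans c' c x' in let y := trans d' d y' in
    eps c' d' x' y' =
      jac (trans d d') y *m eps c d x y *m jac (trans c' c) x' ;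
  eps_unit : forall c d x y,
    cod c x -> cod d y -> eps c d x y \in unitmx ;
  eps_comp : forall c d e x y z,
    cod c x -> cod d y -> cod e z ->
    eps d e y z *m eps c d x y = eps c e x z ;
  eps_inv : forall c d x y,
    cod c x -> cod d y -> eps d c y x = invmx (eps c d x y)
}.

(* d eps^a_r / d x^s + (d eps^a_r / d y^b) eps^b_s *)
Definition eps_deriv (eps : ecomp) (c d : chart X) (x y : 'rV[R]_n)
    (a r s : 'I_n) : R :=
  pd s (fun u => eps c d u y a r) x
  + \sum_(b < n) pd b (fun v => eps c d x v a r) y * eps c d x y b s.

Definition curvature (eps : ecomp) (c d : chart X) (x y : 'rV[R]_n)
    (a r s : 'I_n) : R :=
  eps_deriv eps c d x y a r s - eps_deriv eps c d x y a s r.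

Record local_Lie_group (eps : ecomp) : Prop := LocalLieGroup {
  llg_splitting : is_splitting eps ;
  llg_integrable : forall c d x y a r s,
    cod c x -> cod d y -> curvature eps c d x y a r s = 0
}.

(* [GammaT eps c x i k j] is the derivative of eps^i_j(x, y) along y^k. *)
Definition GammaT (eps : ecomp) (c : chart X) (x : 'rV[R]_n)
    (i k j : 'I_n) : R :=
  pd k (fun y => eps c c x y i j) x.

Definition GammaH (eps : ecomp) (c : chart X) (x : 'rV[R]_n)
    (i j k : 'I_n) : R :=
  GammaT eps c x i k j.

(* A k-form is given by its k! -normalized components: the form with components
   w_I is (1/k!) w_{i_1...i_k} dx^{i_1} /\ ... /\ dx^{i_k}, w_I alternating. *)
Notation mindex k := {ffun 'I_k -> 'I_n}.

Definition alternating (k : nat) (w : mindex k -> R) : Prop :=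
  forall (s : 'S_k) (I : mindex k), w [ffun t => I (s t)] = (-1) ^+ s * w I.

Definition hcomp (k : nat) : Type :=
  chart X -> chart X -> 'rV[R]_n -> 'rV[R]_n -> mindex k -> R.

Record hforms (k : nat) (w : hcomp k) : Prop := HForm {
  hform_alt : forall c d x y,
    cod c x -> cod d y -> alternating (w c d x y) ;
  hform_smooth : forall c d I,
    smooth (cod c `*` cod d) (fun z => w c d z.1 z.2 I) ;
  hform_change : forall c c' d d' x' y' J,
    overlap c' c x' -> overlap d' d y' ->
    w c' d' x' y' J =
      \sum_(I : mindex k) w c d (trans c' c x') (trans d' d y') I
                          * \prod_t jac (trans c' c) x' (I t) (J t)
}.

(* [s c x a I] is s_{a,I}(x), i.e. the k-form at x obtained from the tangent
   vector xi = d/dx^a. *)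
Definition tcomp (k : nat) : Type :=
  chart X -> 'rV[R]_n -> 'I_n -> mindex k -> R.

Record tforms (k : nat) (s : tcomp k) : Prop := TForm {
  tform_alt : forall c x a, cod c x -> alternating (s c x a) ;
  tform_smooth : forall c a I, smooth (cod c) (fun x => s c x a I) ;
  tform_change : forall c c' x' a J,
    overlap c' c x' ->
    s c' x' a J =
      \sum_(b < n) \sum_(I : mindex k) s c (trans c' c x') b I
        * jac (trans c' c) x' b a * \prod_t jac (trans c' c) x' (I t) (J t)
}.

Definition tform_eq (k : nat) (s1 s2 : tcomp k) : Prop :=
  forall c x a I, cod c x -> s1 c x a I = s2 c x a I.

(* Components of the (k+1)-form (1/k!) th_{r,I} dx^r /\ dx^{i_1} /\ ... /\
   dx^{i_k}: since the component of dx^{j_0} /\ ... /\ dx^{j_k} at J' is the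
   sum over permutations p of sgn(p) [J' o p = J], the component at J is
   (1/k!) sum_p sgn(p) th_{j_p(0), (j_p(1), ..., j_p(k))}. *)
Definition dx_wedge (k : nat) (th : 'I_n -> mindex k -> R) (J : mindex k.+1)
    : R :=
  (k`!%:R)^-1 * \sum_(p : 'S_k.+1)
    (-1) ^+ p * th (J (p ord0)) [ffun t : 'I_k => J (p (lift ord0 t))].

Definition dtilde (eps : ecomp) (k : nat) (w : hcomp k) : hcomp k.+1 :=
  fun c d x y => dx_wedge (fun r I =>
    pd r (fun u => w c d u y I) x
    + \sum_(a < n) pd a (fun v => w c d x v I) y * eps c d x y a r).

Definition dhat (eps : ecomp) (k : nat) (s : tcomp k) : tcomp k.+1 :=
  fun c x a => dx_wedge (fun r I =>
    pd r (fun u => s c u a I) x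
    + \sum_(b < n) s c x b I * GammaH eps c x b r a).

(* pd a is the derivative at t = 0 of t |-> w_I(x, x + t xi), xi = d/dx^a. *)
Definition lin (k : nat) (w : hcomp k) : tcomp k :=
  fun c x a I => pd a (fun y => w c c x y I) x.

End NonlinearForms.

(* Main.v *)
(* In charts, [dtilde] and [dhat] antisymmetrize a derivative of the components,
   and both transformation laws have the same source: the derivatives of the
   Jacobian of the chart change that appear are symmetric second derivatives, so
   antisymmetrization kills them.  For [dhat] the remaining second derivative is
   absorbed by the inhomogeneous term of the transformation law of Gamma,
   obtained by differentiating A(y') eps'(x', y') = eps(x, y) A(x') in y' at
   y' = x'.  Commutation of the diagram is then the symmetry of second
   derivatives on M x M, together with eps(x, x) = 1. *)
Require Import Defs.
From HB Require Import structures.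
From mathcomp Require Import all_boot all_order all_algebra.
From mathcomp Require Import fingroup perm.
From mathcomp Require Import boolp classical_sets functions reals topology.
From mathcomp Require Import interval_inference normedtype landau derive.
From mathcomp Require Import ring.

Set Implicit Arguments.
Unset Strict Implicit.
Unset Printing Implicit Defensive.

Import Order.TTheory GRing.Theory Num.Theory.
Import numFieldNormedType.Exports.

Local Open Scope classical_set_scope.
Local Open Scope ring_scope.

(** * Symmetry of second derivatives *)

(** The difference [g - f] vanishes near [x], so its first-order expansion there has zero linear
    part; [g] is this difference plus [f]. *)
Lemma near_eq_differentiable (R : realType) (V W : normedModType R)
    (f g : V -> W) (x : V) :
  {near x, f =1 g} -> differentiable f x -> differentiable g x.
Proof.
move=> fg df; pose h := g - f.
have h0 : h \o shift x = cst (h x) + (\0 : {linear V -> W}) +o_ 0 id.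
  apply/eqaddoP => _/posnumP[e].
  have hx : h x = 0 by rewrite /h fctE -(nbhs_singleton fg) subrr.
  have : \forall y \near (0 : V), f (y + x) = g (y + x).
    rewrite (near_shift x) /=; near=> y.
    by rewrite sub0r /= subrK; near: y.
  apply: filterS => y fgy.
  rewrite !fctE /= hx /h !fctE fgy subrr !addr0 subrr normr0.
  by rewrite mulr_ge0.
have c0 : continuous ((\0 : {linear V -> W}) : V -> W).
  by move=> y; exact: cvg_cst.
have -> : g = h + f by rewrite /h subrK.
apply: differentiableD => //.
apply/diff_locallyP; rewrite (diff_unique c0 h0).
Unshelve. all: by end_near. Qed.

(** The map [g] carries the line through [x] along [v] affinely to the line through [g x] along [u],
    so the two difference quotients are equal for every [h], before any limit is taken. *)
Lemma derive_along (R : realType) (V V' W : normedModType R)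
    (F : V' -> W) (g : V -> V') (v : V) (u : V') (x : V) :
  (forall h : R, g (h *: v + x) = h *: u + g x) ->
  'D_v (F \o g) x = 'D_u F (g x).
Proof.
move=> gE; rewrite /derive.
suff -> : (fun h : R => h^-1 *: (((F \o g) \o shift x) (h *: v) - (F \o g) x)) =
  (fun h => h^-1 *: ((F \o shift (g x)) (h *: u) - F (g x))) by [].
by apply/funext => h /=; rewrite gE.
Qed.

Lemma derivable_along (R : realType) (V V' W : normedModType R)
    (F : V' -> W) (g : V -> V') (v : V) (u : V') (x : V) :
  (forall h : R, g (h *: v + x) = h *: u + g x) ->
  derivable F (g x) u -> derivable (F \o g) x v.
Proof.
move=> gE; rewrite /derivable.
suff -> : (fun h : R => h^-1 *: (((F \o g) \o shift x) (h *: v) - (F \o g) x)) =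
  (fun h => h^-1 *: ((F \o shift (g x)) (h *: u) - F (g x))) by [].
by apply/funext => h /=; rewrite gE.
Qed.

Lemma is_derive_comp (R : realType) (V V' W : normedModType R)
    (F : V' -> W) (g : V -> V') (v : V) (x : V) :
  differentiable g x -> differentiable F (g x) ->
  is_derive x v (F \o g) ('D_('D_v g x) F (g x)).
Proof.
move=> dg dF; have dFg := differentiable_comp dg dF.
split; first exact: diff_derivable.
by rewrite !deriveE // diff_comp.
Qed.

Lemma MVT_line (R : realType) (V : normedModType R) (f : V -> R) (y v : V)
    (h : R) : 0 < h ->
  (forall t, t \in `[0, h] -> differentiable f (t *: v + y)) ->
  exists2 c, c \in `[0, h] & f (h *: v + y) - f y = h * 'D_v f (c *: v + y).
Proof.
move=> h0 df.
pose g (t : R) := t *: v + y.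
have gE t e : g (e *: 1 + t) = e *: v + g t.
  by rewrite /g scalerDl addrA [e *: 1]mulr1.
have dfg t : t \in `[0, h] -> derivable (f \o g) t 1.
  move=> t0; apply: (derivable_along (gE t)).
  exact/diff_derivable/df.
have [t||c c0] := @MVT R (f \o g) (fun t => 'D_v f (g t)) 0 h h0.
- move=> t0; have {}t0 : t \in `[0, h] by apply: subset_itv_oo_cc.
  split; first exact: dfg.
  by rewrite (derive_along _ (gE t)).
- exact: derivable_within_continuous.
rewrite /g /= scale0r add0r subr0 => E; exists c; first exact: subset_itv_oo_cc.
by rewrite mulrC.
Qed.

(** The second difference is the increment along [v] of [z |-> f (z + h w) - f z]. A first mean
    value, along [v], turns it into [h] times an increment of ['D_v f] along [w], to which a second
    mean value applies. *)
Lemma second_difference (R : realType) (V : normedModType R) (U : set V)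
    (f : V -> R) (x v w : V) (h : R) : 0 < h -> Ck 2 U f ->
  (forall s t, s \in `[0, h] -> t \in `[0, h] -> U (t *: w + (s *: v + x))) ->
  exists s t, [/\ s \in `[0, h], t \in `[0, h] &
   f (h *: w + (h *: v + x)) - f (h *: w + x) - (f (h *: v + x) - f x) =
   h * (h * 'D_w ('D_v f) (t *: w + (s *: v + x)))].
Proof.
move=> h0 [df /(_ v)[ddf _]] Ux.
have h_in : h \in `[0, h] by rewrite in_itv /= lexx ltW.
have z_in : 0 \in `[0, h] by rewrite in_itv /= lexx ltW.
pose g := (f \o shift (h *: w)) - f.
have sE z (e : R) : shift (h *: w) (e *: v + z) = e *: v + shift (h *: w) z.
  by rewrite /= addrA.
have dfs s : s \in `[0, h] -> differentiable f (s *: v + x).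
  by move=> s0; apply: df; have := Ux _ _ s0 z_in; rewrite scale0r add0r.
have dfs' s : s \in `[0, h] -> differentiable f (shift (h *: w) (s *: v + x)).
  by move=> s0; apply: df; rewrite /= addrC; exact: Ux.
have dsh z : differentiable (shift (h *: w)) z.
  by apply: differentiableD.
have [s s0|s s0 gE] := @MVT_line R V g x v h h0.
  apply: differentiableB; last exact: dfs.
  by apply: differentiable_comp => //; exact: dfs'.
have [t t0|t t0 E] := @MVT_line R V ('D_v f) (s *: v + x) w h h0.
  exact/ddf/Ux.
exists s, t; split => //; rewrite -E.
have <- : 'D_v g (s *: v + x) =
    'D_v f (h *: w + (s *: v + x)) - 'D_v f (s *: v + x).
  rewrite /g deriveB; last 2 first.
  - by apply: (derivable_along (sE _)); exact/diff_derivable/dfs'.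
  - exact/diff_derivable/dfs.
  by rewrite (derive_along _ (sE _)) /= addrC [_ + h *: w]addrC addrC.
rewrite -gE /g !fctE /= ![_ + h *: w]addrC; ring.
Qed.

(* By the mean value theorem, applied twice, the same second difference is a value
   of either mixed derivative at points arbitrarily close to x. *)
Lemma derive_swap (R : realType) (V : normedModType R) (U : set V)
    (f : V -> R) (x v w : V) : open U -> Ck 2 U f -> U x ->
  'D_w ('D_v f) x = 'D_v ('D_w f) x.
Proof.
move=> oU fC Ux; apply/eqP; rewrite -subr_eq0; apply: contraT => ab0.
set a := 'D_w ('D_v f) x in ab0 *; set b := 'D_v ('D_w f) x in ab0 *.
(* With half the gap as radius, no number is this close to both [a] and [b]; the proof exhibits one
   that would be. *)
have e0 : 0 < `|a - b| / 2 by rewrite divr_gt0 ?normr_gt0.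
have Ca : {for x, continuous ('D_w ('D_v f))}.
  exact: ((fC.2 v).2 w x Ux).
have Cb : {for x, continuous ('D_v ('D_w f))}.
  exact: ((fC.2 w).2 v x Ux).
have NU : nbhs x U by exact: open_nbhs_nbhs.
have Na : \forall y \near x, `|a - 'D_w ('D_v f) y| < `|a - b| / 2.
  exact: ((cvgrPdist_lt _ _).1 Ca).
have Nb : \forall y \near x, `|b - 'D_v ('D_w f) y| < `|a - b| / 2.
  exact: ((cvgrPdist_lt _ _).1 Cb).
have : nbhs x (U `&` ([set y | `|a - 'D_w ('D_v f) y| < `|a - b| / 2] `&`
                      [set y | `|b - 'D_v ('D_w f) y| < `|a - b| / 2])).
  exact: (filterI NU (filterI Na Nb)).
move=> /nbhs_ballP[r /= r0 rU].
(* This size keeps the whole parallelogram with sides [h v] and [h w] inside the ball; the summand 1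
   makes the denominator positive and the bound strict. *)
pose h := r / (`|v| + `|w| + 1).
have d0 : 0 < `|v| + `|w| + 1 by rewrite ltr_wpDl// addr_ge0.
have h0 : 0 < h by rewrite divr_gt0.
have xr s t : s \in `[0, h] -> t \in `[0, h] ->
    ball x r (t *: w + (s *: v + x)).
  rewrite !in_itv /= => /andP[s0 sh] /andP[t0 th].
  rewrite -ball_normE /= opprD addrC opprD -!addrA [- x + x]addNr addr0.
  rewrite (le_lt_trans (ler_normB _ _)) // normrN !normrZ !ger0_norm //.
  have -> : r = h * (`|v| + `|w| + 1) by rewrite /h divfK // gt_eqF.
  rewrite !mulrDr mulr1 addrC; apply: (@le_lt_trans _ _ (h * `|v| + h * `|w|)).
    by rewrite lerD // ler_wpM2r.
  by rewrite ltrDl.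
have [s [t [s0 t0 E1]]] := @second_difference R V U f x v w h h0 fC
  (fun s t s0 t0 => (rU _ (xr s t s0 t0)).1).
have xr' s' t' : s' \in `[0, h] -> t' \in `[0, h] ->
    ball x r (t' *: v + (s' *: w + x)).
  by move=> s'0 t'0; rewrite addrCA; exact: xr.
have [t' [s' [t'0 s'0 E2]]] := @second_difference R V U f x w v h h0 fC
  (fun s t s0 t0 => (rU _ (xr' s t s0 t0)).1).
(* Exchanging [v] and [w] leaves the second difference unchanged, so both values equal it divided by
   [h ^ 2]. *)
have E : 'D_w ('D_v f) (t *: w + (s *: v + x)) =
         'D_v ('D_w f) (s' *: v + (t' *: w + x)).
  have hh0 : h != 0 by rewrite gt_eqF.
  apply: (mulfI hh0); apply: (mulfI hh0).
  apply: etrans (esym E1) _; apply: etrans _ E2.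
  rewrite [h *: v + (h *: w + x)]addrCA.
  ring.
have A : `|a - 'D_w ('D_v f) (t *: w + (s *: v + x))| < `|a - b| / 2.
  exact: (rU _ (xr _ _ s0 t0)).2.1.
have B : `|b - 'D_v ('D_w f) (s' *: v + (t' *: w + x))| < `|a - b| / 2.
  exact: (rU _ (xr' _ _ t'0 s'0)).2.2.
have far (p q z : R) :
    `|p - z| < `|p - q| / 2 -> `|q - z| < `|p - q| / 2 -> False.
  move=> pz qz; have := ltrD pz qz.
  rewrite -splitr [`|q - z|]distrC => /(le_lt_trans (ler_normD _ _)).
  by rewrite addrA subrK ltxx.
by rewrite E in A; case: (far _ _ _ A B).
Qed.

(** * Smooth functions *)

Section SmoothFunctions.
Variable R : realType.
Implicit Types V W : normedModType R.

(** A derivative depends only on the germ of the function, so on an open set equality passes to all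
    directional derivatives and the induction goes through. This is how differentiation rules valid
    only on [U] are substituted under [Ck]. *)
Lemma Ck_eq V W k (U : set V) (f g : V -> W) : open U ->
  (forall x, U x -> f x = g x) -> Ck k U f -> Ck k U g.
Proof.
move=> oU; elim: k f g => [|k IH] f g fg /=.
  move=> fc x Ux; suff : g @ x --> f x by rewrite fg.
  apply: cvg_trans (fc x Ux); apply: near_eq_cvg.
  by apply: filterS (open_nbhs_nbhs (conj oU Ux)) => y; exact: fg.
have nfg x : U x -> {near x, f =1 g}.
  by move=> Ux; apply: filterS (open_nbhs_nbhs (conj oU Ux)) => y; exact: fg.
move=> [df dfk]; split=> [x Ux|v].
  by apply: near_eq_differentiable (df x Ux); exact: nfg.
by apply: IH (dfk v) => x Ux; apply: near_eq_derive; exact: nfg.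
Qed.

Lemma CkW V W k (U : set V) (f : V -> W) : Ck k.+1 U f -> Ck k U f.
Proof.
elim: k f => [|k IH] f; first by case=> df _ x /df /differentiable_continuous.
by case=> df dfk; split=> // v; exact: IH.
Qed.

Lemma Ck_cst V W k (U : set V) (a : W) : Ck k U (fun=> a).
Proof.
elim: k a => [|k IH] a; first by move=> x _; exact: cvg_cst.
split=> [x _|v]; first exact: differentiable_cst.
suff -> : (fun x : V => 'D_v (fun=> a) x) = fun=> 0 by exact: IH.
by apply/funext => x; exact: derive_cst.
Qed.

Lemma CkD V W k (U : set V) (f g : V -> W) : open U ->
  Ck k U f -> Ck k U g -> Ck k U (fun x => f x + g x).
Proof.
move=> oU; elim: k f g => [|k IH] f g.
  by move=> fc gc x Ux; apply: continuousD; [exact: fc|exact: gc].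
move=> [df dfk] [dg dgk]; split=> [x Ux|v].
  by apply: differentiableD; [exact: df|exact: dg].
apply: Ck_eq oU _ (IH _ _ (dfk v) (dgk v)) => x Ux.
by rewrite -deriveD //; exact/diff_derivable/df + exact/diff_derivable/dg.
Qed.

(** Leibniz rule; [CkW] lowers the undifferentiated factors to the order of the induction
    hypothesis. *)
Lemma CkM V k (U : set V) (f g : V -> R) : open U ->
  Ck k U f -> Ck k U g -> Ck k U (fun x => f x * g x).
Proof.
move=> oU; elim: k f g => [|k IH] f g.
  by move=> fc gc x Ux; apply: continuousM; [exact: fc|exact: gc].
move=> fk gk; have [df dfk] := fk; have [dg dgk] := gk; split=> [x Ux|v].
  by apply: differentiableM; [exact: df|exact: dg].
apply: Ck_eq oU _ (CkD oU (IH _ _ (CkW fk) (dgk v)) (IH _ _ (CkW gk) (dfk v))).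
move=> x Ux; rewrite -[RHS]/('D_v (f * g) x) deriveM //.
  exact/diff_derivable/df.
exact/diff_derivable/dg.
Qed.

(** For linear [L], the derivative of the composite along [v] is the derivative of [f] along the
    constant vector [L v], so the induction hypothesis applies directly. *)
Lemma Ck_precomp V V' W k (U : set V) (U' : set V') (f : V' -> W)
    (L : {linear V -> V'}) : continuous L -> (forall x, U x -> U' (L x)) ->
  Ck k U' f -> Ck k U (fun x => f (L x)).
Proof.
move=> Lc UU'; elim: k f => [|k IH] f /=.
  by move=> fc x Ux; apply: continuous_comp; [exact: Lc|exact/fc/UU'].
move=> [df dfk]; split=> [x Ux|v].
  apply: differentiable_comp; first exact: linear_differentiable.
  exact/df/UU'.
suff -> : (fun x => 'D_v (fun y => f (L y)) x) = fun x => 'D_(L v) f (L x).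
  exact: IH (dfk (L v)).
by apply/funext => x; apply: derive_along => h; rewrite linearP.
Qed.

Lemma Ck_coord V m n k (U : set V) (f : V -> 'M[R]_(m, n)) i j : open U ->
  Ck k U f -> Ck k U (fun x => f x i j).
Proof.
move=> oU; elim: k f => [|k IH] f /=.
  move=> fc x Ux; apply: (@continuous_comp _ _ _ f (fun A => A i j)).
    exact: fc.
  exact: coord_continuous.
move=> [df dfk]; split=> [x Ux|v].
  apply: (@differentiable_comp _ _ _ _ f (fun A => A i j)); first exact: df.
  exact: differentiable_coord.
apply: Ck_eq oU _ (IH _ (dfk v)) => x Ux.
by rewrite derive_mx ?mxE //; exact/diff_derivable/df.
Qed.

Variables (V : normedModType R) (U : set V).
Hypothesis oU : open U.

Lemma smooth_differentiable W (f : V -> W) x :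
  smooth U f -> U x -> differentiable f x.
Proof. by move=> /(_ 1)[df _]; exact: df. Qed.

Lemma smooth_derive W (f : V -> W) v : smooth U f -> smooth U ('D_v f).
Proof. by move=> fs k; have [_] := fs k.+1; exact. Qed.

Lemma smooth_eq W (f g : V -> W) :
  (forall x, U x -> f x = g x) -> smooth U f -> smooth U g.
Proof. by move=> fg fs k; exact: Ck_eq oU fg (fs k). Qed.

Lemma smooth_cst W (a : W) : smooth U (fun=> a).
Proof. by move=> k; exact: Ck_cst. Qed.

Lemma smoothM (f g : V -> R) :
  smooth U f -> smooth U g -> smooth U (fun x => f x * g x).
Proof. by move=> fs gs k; exact: CkM. Qed.

Lemma smoothD W (f g : V -> W) :
  smooth U f -> smooth U g -> smooth U (fun x => f x + g x).
Proof. by move=> fs gs k; exact: CkD. Qed.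

Lemma smooth_sum W (I : Type) (r : seq I) (P : pred I) (f : I -> V -> W) :
  (forall i, P i -> smooth U (f i)) ->
  smooth U (fun x => \sum_(i <- r | P i) f i x).
Proof.
move=> fs; rewrite (_ : (fun x => _) = \sum_(i <- r | P i) f i); last first.
  by apply/funext => x; rewrite fct_sumE.
by elim/big_ind: _ => //; [exact: smooth_cst|exact: smoothD].
Qed.

Lemma smooth_precomp V' W (U' : set V') (f : V' -> W) (L : {linear V -> V'}) :
  continuous L -> (forall x, U x -> U' (L x)) ->
  smooth U' f -> smooth U (fun x => f (L x)).
Proof. by move=> Lc UU' fs k; exact: Ck_precomp Lc UU' (fs k). Qed.

Lemma smooth_coord m n (f : V -> 'M[R]_(m, n)) i j :
  smooth U f -> smooth U (fun x => f x i j).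
Proof. by move=> fs k; exact: Ck_coord. Qed.

End SmoothFunctions.

(** * Derivatives of finite sums and products *)

Section DerivativeRules.
Context {R : realType} {V : normedModType R}.
Implicit Types (x v : V).

Lemma is_derive_bigsum (W : normedModType R) (I : Type) (r : seq I) (P : pred I)
    (f : I -> V -> W) (df : I -> W) x v :
  (forall i, is_derive x v (f i) (df i)) ->
  is_derive x v (fun y => \sum_(i <- r | P i) f i y) (\sum_(i <- r | P i) df i).
Proof.
move=> fd; rewrite (_ : (fun y => _) = \sum_(i <- r | P i) f i); last first.
  by apply/funext => y; rewrite fct_sumE.
by elim/big_ind2 : _ => // [|] *; [exact: is_derive_cst|exact: is_deriveD].
Qed.

Lemma is_deriveM_scal (f g : V -> R) (df dg : R) x v :
  is_derive x v f df -> is_derive x v g dg ->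
  is_derive x v (fun y => f y * g y) (df * g x + f x * dg).
Proof.
move=> fd gd; have := is_deriveM fd gd.
by rewrite addrC /GRing.scale /= [g x * df]mulrC.
Qed.

Lemma is_derive_bigprod k (f : 'I_k -> V -> R) (df : 'I_k -> R) x v :
  (forall i, is_derive x v (f i) (df i)) ->
  is_derive x v (fun y => \prod_i f i y)
    (\sum_i df i * \prod_(j | j != i) f j x).
Proof.
move=> fd; elim: k f df fd => [|k IH] f df fd.
  rewrite big_ord0 (_ : (fun y => _) = fun=> 1); first exact: is_derive_cst.
  by apply/funext => y; rewrite big_ord0.
rewrite (_ : (fun y => _) = fun y => f ord0 y * \prod_i f (lift ord0 i) y);
  last by apply/funext => y; rewrite big_ord_recl.
have := is_deriveM_scal (fd ord0) (IH _ _ (fun i => fd (lift ord0 i))).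
congr is_derive; rewrite big_ord_recl; congr (_ * _ + _).
  by rewrite [RHS]big_mkcond big_ord_recl /= mul1r.
rewrite mulr_sumr; apply: eq_bigr => i _.
rewrite mulrCA; congr (_ * _).
rewrite [RHS]big_mkcond big_ord_recl /=; congr (_ * _).
by rewrite big_mkcond.
Qed.

End DerivativeRules.

(** * Antisymmetrization of multi-indexed families *)

Section Wedge.
Context {R : realType} {n : nat}.
Local Notation mindex k := {ffun 'I_k -> 'I_n}.

(** Reindexing the sum by [p * s^-1] undoes [s] in the indices and leaves its sign as a factor. *)
Lemma alternating_dx_wedge k (th : 'I_n -> mindex k -> R) :
  alternating (dx_wedge th).
Proof.
move=> s J; rewrite /dx_wedge mulrCA; congr (_ * _).
rewrite (reindex_inj (mulIg (s^-1)%g)) mulr_sumr; apply: eq_bigr => p _ /=.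
rewrite odd_permM odd_permV signr_addb mulrA [_ * (-1) ^+ s]mulrC.
rewrite ffunE permM permKV; congr (_ * th _ _).
by apply/ffunP => t; rewrite !ffunE permM permKV.
Qed.

Lemma eq_dx_wedge k (th th' : 'I_n -> mindex k -> R) J :
  (forall r I, th r I = th' r I) -> dx_wedge th J = dx_wedge th' J.
Proof.
by move=> E; rewrite /dx_wedge; congr (_ * _); apply: eq_bigr => p _; rewrite E.
Qed.

Lemma dx_wedge_sum k (K : finType) (c : K -> R)
    (th : K -> 'I_n -> mindex k -> R) J :
  dx_wedge (fun r I => \sum_m c m * th m r I) J =
  \sum_m c m * dx_wedge (th m) J.
Proof.
rewrite /dx_wedge; under eq_bigr do rewrite mulr_sumr.
rewrite exchange_big /= mulr_sumr; apply: eq_bigr => m _.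
by rewrite mulrCA; congr (_ * _); rewrite mulr_sumr; apply: eq_bigr => p _;
  rewrite mulrCA.
Qed.

Lemma dx_wedgeD k (th th' : 'I_n -> mindex k -> R) J :
  dx_wedge (fun r I => th r I + th' r I) J = dx_wedge th J + dx_wedge th' J.
Proof.
rewrite /dx_wedge -mulrDr -big_split /=; congr (_ * _).
by apply: eq_bigr => p _; rewrite mulrDr.
Qed.

(** The hypothesis is invariance under exchanging the slot of [r] with slot [t]. Composing [p] with
    the corresponding transposition preserves each summand up to sign, so the sum is its own
    negative. *)
Lemma dx_wedge_symmetric k (th : 'I_n -> mindex k -> R) (t : 'I_k) J :
  (forall r I, th r I = th (I t) [ffun t' => if t' == t then r else I t']) ->
  dx_wedge th J = 0.
Proof.
move=> thS; rewrite /dx_wedge; set S := \sum_p _.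
suff S0 : S = - S.
  have : S *+ 2 = 0 by rewrite mulr2n {1}S0 addNr.
  by move/eqP; rewrite mulrn_eq0 /= => /eqP ->; rewrite mulr0.
rewrite {1}/S (reindex_inj (mulgI (tperm ord0 (lift ord0 t)))) -sumrN.
apply: eq_bigr => p _.
rewrite odd_permM odd_tperm /= signrN mulNr; congr (- (_ * _)).
rewrite thS ffunE !permM tpermL tpermR; congr (th _ _).
apply/ffunP => t'; rewrite !ffunE; case: eqP => [->//|/eqP tt'].
rewrite permM tpermD // (inj_eq lift_inj) eq_sym //.
Qed.

(** The action of a linear map on covariant tensors, not only alternating ones; with a Jacobian for
    [A] it is the sum over [I] in the transformation laws of forms. *)
Definition pullback k (A : 'M[R]_n) (w : mindex k -> R) (J : mindex k) : R :=
  \sum_(I : mindex k) w I * \prod_t A (I t) (J t).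

Lemma pullbackD k A (w w' : mindex k -> R) J :
  pullback A (fun I => w I + w' I) J = pullback A w J + pullback A w' J.
Proof. by rewrite -big_split; apply: eq_bigr => I _; rewrite mulrDl. Qed.

Lemma pullback_sum k A (K : finType) (c : K -> R) (w : K -> mindex k -> R) J :
  pullback A (fun I => \sum_m w m I * c m) J = \sum_m pullback A (w m) J * c m.
Proof.
under [RHS]eq_bigr do rewrite mulr_suml.
rewrite exchange_big; apply: eq_bigr => I _; rewrite mulr_suml.
by apply: eq_bigr => m _; rewrite mulrAC.
Qed.

Definition mindex_cons k (r : 'I_n) (I : mindex k) : mindex k.+1 :=
  [ffun t => if unlift ord0 t is Some t' then I t' else r].

Lemma sum_mindexS k (F : mindex k.+1 -> R) :
  \sum_I F I = \sum_r \sum_I F (mindex_cons r I).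
Proof.
rewrite pair_bigA /=.
rewrite (reindex (fun u : 'I_n * mindex k => mindex_cons u.1 u.2)) //=.
exists (fun I => (I ord0, [ffun t => I (lift ord0 t)])) => [[r I] _|I _] /=.
  congr pair; first by rewrite ffunE unlift_none.
  by apply/ffunP => t; rewrite !ffunE liftK.
apply/ffunP => t; rewrite !ffunE; case: unliftP => [t' ->|-> //].
by rewrite ffunE.
Qed.

(** Antisymmetrization permutes the slots while [A] acts on all slots alike, so the two operations
    commute permutation by permutation. *)
Lemma dx_wedge_pullback k (A : 'M[R]_n) (th : 'I_n -> mindex k -> R) J :
  dx_wedge (fun r I => \sum_s A s r * pullback A (th s) I) J =
  pullback A (dx_wedge th) J.
Proof.
rewrite /pullback /dx_wedge.
under [RHS]eq_bigr do rewrite -mulrA mulr_suml.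
rewrite -mulr_sumr; congr (_ * _).
rewrite exchange_big /=; apply: eq_bigr => p _.
(* Replacing the summation index [I] by its composite with [p^-1] moves the index at slot [p ord0]
   to the head, where [sum_mindexS] splits it off. *)
have hinj : injective (fun I : mindex k.+1 => [ffun t => I (p^-1%g t)]).
  by move=> I I' /ffunP E; apply/ffunP => t; have := E (p t);
    rewrite !ffunE permK.
rewrite [RHS](reindex_inj hinj) sum_mindexS mulr_sumr; apply: eq_bigr => s _.
rewrite !mulr_sumr; apply: eq_bigr => I _ /=.
rewrite !ffunE permK unlift_none -!mulrA; congr (_ * _).
rewrite mulrCA; congr (_ * _).
  by congr (th _ _); apply/ffunP => t; rewrite !ffunE permK liftK.
rewrite (reindex_inj (@perm_inj _ p)) big_ord_recl !ffunE permK unlift_none.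
by congr (_ * _); apply: eq_bigr => t _; rewrite !ffunE permK liftK.
Qed.

(** This is the term left by the product rule when a product of Jacobian entries is differentiated.
    In each summand the symmetry of [H] exchanges the derivative index with the index in slot
    [t]. *)
Lemma dx_wedge_hessian k (A : 'M[R]_n) (H : 'I_n -> 'M[R]_n)
    (w : mindex k -> R) J :
  (forall r i j, H r i j = H j i r) ->
  dx_wedge (fun r K => \sum_I w I *
     \sum_t H r (I t) (K t) * \prod_(t' | t' != t) A (I t') (K t')) J = 0.
Proof.
move=> HS; rewrite dx_wedge_sum big1 // => I _; apply/eqP; rewrite mulf_eq0.
apply/orP; right; apply/eqP.
rewrite (@eq_dx_wedge _ _ (fun r K => \sum_t 1 *
  (H r (I t) (K t) * \prod_(t' | t' != t) A (I t') (K t')))); last first.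
  by move=> r K; apply: eq_bigr => t _; rewrite mul1r.
rewrite dx_wedge_sum big1 // => t _; rewrite mul1r.
apply: (@dx_wedge_symmetric _ _ t) => r K; rewrite HS ffunE eqxx; congr (_ * _).
by apply: eq_bigr => t' /negbTE t't; rewrite ffunE t't.
Qed.

End Wedge.

(** * Changes of charts *)

Section Charts.
Context {R : realType} {n : nat} {M : topologicalType} (X : manifold R n M).
Implicit Types c d : chart X.

Lemma overlap_cod c c' x : overlap c c' x -> cod c x.
Proof. by move=> [p [pc _] <-]; exists p. Qed.

Lemma overlap_refl c x : cod c x -> overlap c c x.
Proof. by move=> [p pc <-]; exists p. Qed.

(** Within the open set [cod c], the overlap is the preimage of the open set [dom c'] under [pnt c],
    which is continuous there. *)
Lemma open_overlap c c' : open (overlap c c').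
Proof.
rewrite openE => x [p [pc pc'] px].
have cx : cod c x by exists p.
have pE : pnt c x = p by rewrite -px crdK.
have N : nbhs (pnt c x) (dom c').
  by rewrite pE; apply: open_nbhs_nbhs; split; first exact: dom_open.
have : nbhs x (cod c `&` pnt c @^-1` dom c').
  apply: filterI; last exact: pnt_continuous N.
  by apply: open_nbhs_nbhs; split; first exact: cod_open.
apply: filterS => _ [[q qc <-] /=]; rewrite crdK // => qc'.
by exists q.
Qed.

Lemma trans_overlap c c' x : overlap c c' x -> overlap c' c (trans c c' x).
Proof. by move=> [p [pc pc'] <-]; exists p; rewrite // /trans /= crdK. Qed.

Lemma transK c c' x : overlap c c' x -> trans c' c (trans c c' x) = x.
Proof. by move=> [p [pc pc'] <-]; rewrite /trans /= !crdK. Qed.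

Lemma trans_differentiable c c' x :
  overlap c c' x -> differentiable (trans c c') x.
Proof. exact/smooth_differentiable/trans_smooth. Qed.

Lemma jacE (f : 'rV[R]_n -> 'rV[R]_n) x a b : differentiable f x ->
  jac f x a b = 'D_(delta_mx ord0 b) f x ord0 a.
Proof. by move=> df; rewrite mxE derive_mx ?mxE //; exact: diff_derivable. Qed.

Lemma smooth_jac c c' a b :
  smooth (overlap c c') (fun u => jac (trans c c') u a b).
Proof.
rewrite (_ : (fun u => _) = pd b (fun u => trans c c' u ord0 a)).
  apply: smooth_derive; apply: smooth_coord; first exact: open_overlap.
  exact: trans_smooth.
by apply/funext => u; rewrite mxE.
Qed.

Lemma jac_sym c c' x r a b : overlap c c' x ->
  pd r (fun u => jac (trans c c') u a b) x =
  pd b (fun u => jac (trans c c') u a r) x.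
Proof.
move=> cx.
have jE s : (fun u => jac (trans c c') u a s) =
    pd s (fun u => trans c c' u ord0 a).
  by apply/funext => u; rewrite mxE.
have fC : Ck 2 (overlap c c') (fun u => trans c c' u ord0 a).
  by apply: smooth_coord; [exact: open_overlap|exact: trans_smooth].
rewrite !jE; exact: (derive_swap _ _ (@open_overlap c c') fC cx).
Qed.

Lemma derive_rV (W : normedModType R) (f : 'rV[R]_n -> W) x (v : 'rV[R]_n) :
  differentiable f x ->
  'D_v f x = \sum_b v ord0 b *: 'D_(delta_mx ord0 b) f x.
Proof.
move=> df; rewrite deriveE // {1}[v]row_sum_delta linear_sum.
by apply: eq_bigr => b _; rewrite linearZ deriveE.
Qed.

Lemma is_derive_trans c c' (f : 'rV[R]_n -> R) x r :
  overlap c c' x -> differentiable f (trans c c' x) ->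
  is_derive x (delta_mx ord0 r) (fun u => f (trans c c' u))
    (\sum_s jac (trans c c') x s r * pd s f (trans c c' x)).
Proof.
move=> cx df; have dT := trans_differentiable cx.
have := is_derive_comp (delta_mx ord0 r) dT df.
congr is_derive; rewrite derive_rV //; apply: eq_bigr => s _.
by rewrite jacE.
Qed.

(** Chain rule for [trans c' c] after [trans c c'], which agrees with the identity on the overlap
    and hence near [x]. *)
Lemma jacK c c' x : overlap c c' x ->
  jac (trans c' c) (trans c c' x) *m jac (trans c c') x = 1%:M.
Proof.
move=> cx; apply/matrixP => a b; rewrite !mxE.
have dT' := trans_differentiable (trans_overlap cx).
pose f u := trans c' c u ord0 a.
have df : differentiable f (trans c c' x).
  apply: (@differentiable_comp _ _ _ _ (trans c' c) (fun A => A ord0 a)) => //.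
  exact: differentiable_coord.
have [_ E] := is_derive_trans b cx df.
transitivity (pd b (fun u : 'rV[R]_n => u ord0 a) x); last first.
  rewrite /pd -[LHS]/('D__ (fun u : 'rV[R]_n => id u ord0 a) x).
  have did : derivable (id : 'rV[R]_n -> 'rV[R]_n) x (delta_mx ord0 b).
    by apply: derivable_id.
  have := derive_mx did.
  rewrite derive_id => /matrixP /(_ ord0 a); rewrite !mxE /= => <-.
  by rewrite eq_sym.
rewrite /pd.
rewrite -(@near_eq_derive _ _ _ (fun u => f (trans c c' u)) _ x); last first.
  apply: filterS (open_nbhs_nbhs (conj (@open_overlap c c') cx)) => u cu.
  by rewrite /f transK.
rewrite E; apply: eq_bigr => s _; rewrite mulrC; congr (_ * _).
by rewrite mxE.
Qed.

End Charts.

(** * Partial derivatives on a product and restriction to the diagonal *)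

Section Partial.
Context {R : realType} {n : nat}.
Local Notation V := 'rV[R]_n.

(** Rewrites a partial derivative as a derivative along a vector of the product, the form in which
    joint smoothness and [derive_swap] can be used. *)
Lemma pd_fst (F : V * V -> R) x y r :
  pd r (fun u => F (u, y)) x = 'D_(delta_mx ord0 r, 0) F (x, y).
Proof.
apply: (@derive_along _ _ _ _ F (fun u => (u, y)) _
  (delta_mx ord0 r, 0) x) => h.
by congr pair; rewrite /= ?scaler0 ?add0r.
Qed.

Lemma pd_snd (F : V * V -> R) x y r :
  pd r (fun v => F (x, v)) y = 'D_(0, delta_mx ord0 r) F (x, y).
Proof.
apply: (@derive_along _ _ _ _ F (fun v => (x, v)) _
  (0, delta_mx ord0 r) y) => h.
by congr pair; rewrite /= ?scaler0 ?add0r.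
Qed.

Lemma differentiable_fst (F : V * V -> R) x y :
  differentiable F (x, y) -> differentiable (fun u => F (u, y)) x.
Proof.
by move=> dF; apply: (@differentiable_comp _ _ _ _ (fun u => (u, y))) => //;
  apply: differentiable_pair.
Qed.

Lemma differentiable_snd (F : V * V -> R) x y :
  differentiable F (x, y) -> differentiable (fun v => F (x, v)) y.
Proof.
by move=> dF; apply: (@differentiable_comp _ _ _ _ (fun v => (x, v))) => //;
  apply: differentiable_pair.
Qed.

(** Named so that it can carry a linear structure, as [smooth_precomp] requires. *)
Definition diag (x : V) : V * V := (x, x).

Fact diag_is_linear : linear diag.
Proof. by []. Qed.

HB.instance Definition _ := GRing.isLinear.Build R V (V * V)%type _ diag
  diag_is_linear.

Lemma diag_continuous : continuous diag.
Proof.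
move=> x; apply: (@differentiable_continuous _ _ _ x diag).
exact: differentiable_pair.
Qed.

Lemma open_setX (U U' : set V) : open U -> open U' -> open (U `*` U').
Proof.
rewrite !openE => oU oU' [x y] [/= Ux U'y].
by exists (U, U'); first by split; [exact: oU|exact: oU'].
Qed.

(** Differentiate on the product first, then restrict to the diagonal. This gives the smoothness of
    both [lin] and [GammaH]. *)
Lemma smooth_pd_diag (U : set V) (F : V * V -> R) a :
  smooth (U `*` U) F -> smooth U (fun x => pd a (fun y => F (x, y)) x).
Proof.
move=> Fs.
rewrite (_ : (fun x => _) = fun x => 'D_(0, delta_mx ord0 a) F (diag x)).
  apply: smooth_precomp (smooth_derive _ Fs) => //; exact: diag_continuous.
by apply/funext => x; rewrite pd_snd.
Qed.

Lemma smooth_dx_wedge (W : normedModType R) (U : set W) k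
    (th : W -> 'I_n -> {ffun 'I_k -> 'I_n} -> R) J : open U ->
  (forall r I, smooth U (fun z => th z r I)) ->
  smooth U (fun z => dx_wedge (th z) J).
Proof.
move=> oU ths; apply: smoothM => //; first exact: smooth_cst.
by apply: smooth_sum => // p _; apply: smoothM => //; exact: smooth_cst.
Qed.

End Partial.

(** * Derivatives of pullbacks along a change of charts *)

Section ChartDerivatives.
Context {R : realType} {n : nat} {M : topologicalType} (X : manifold R n M).
Variables (c c' : chart X) (x' : 'rV[R]_n) (cx : overlap c' c x').
Let T := trans c' c.
Let x := T x'.
Let A := jac T x'.
Let H r := \matrix_(i, j) pd r (fun u => jac T u i j) x'.

Lemma differentiable_jac i j : differentiable (fun u => jac T u i j) x'.
Proof. exact: (smooth_differentiable (@smooth_jac _ _ _ X c' c i j) cx). Qed.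

Lemma hessianE r i j : H r i j = pd r (fun u => jac T u i j) x'.
Proof. exact: mxE. Qed.

Lemma is_derive_jac r i j :
  is_derive x' (delta_mx ord0 r) (fun u => jac T u i j) (H r i j).
Proof.
by rewrite hessianE; apply: derivableP; exact/diff_derivable/differentiable_jac.
Qed.

Lemma hessian_sym r i j : H r i j = H j i r.
Proof.
apply: etrans (hessianE r i j) _.
exact: etrans (jac_sym r i j cx) (esym (hessianE j i r)).
Qed.

(** The matrix [B] stays constant: this is the situation of a horizontal form differentiated in its
    second argument, since its indices transform by the Jacobian of the first. *)
Lemma is_derive_pullback_trans k (B : 'M[R]_n)
    (g : 'rV[R]_n -> {ffun 'I_k -> 'I_n} -> R) r J :
  (forall I, differentiable (g^~ I) x) ->
  is_derive x' (delta_mx ord0 r) (fun u => pullback B (g (T u)) J)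
    (\sum_s A s r * pullback B (fun I => pd s (g^~ I) x) J).
Proof.
move=> dg.
have E I := is_deriveM_scal (is_derive_trans r cx (dg I))
  (is_derive_cst (\prod_t B (I t) (J t)) x' (delta_mx ord0 r)).
have := is_derive_bigsum (index_enum _) xpredT E.
congr is_derive; rewrite /pullback.
under [RHS]eq_bigr do rewrite mulr_sumr.
rewrite exchange_big; apply: eq_bigr => I _; rewrite mulr0 addr0 mulr_suml.
by apply: eq_bigr => s _; rewrite mulrA.
Qed.

(** Here the Jacobian varies too, so the product rule adds to the tensorial term a Hessian term of
    the shape treated by [dx_wedge_hessian]. *)
Lemma is_derive_pullback k (g : 'rV[R]_n -> {ffun 'I_k -> 'I_n} -> R) r J :
  (forall I, differentiable (g^~ I) x) ->
  is_derive x' (delta_mx ord0 r) (fun u => pullback (jac T u) (g (T u)) J)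
    (\sum_s A s r * pullback A (fun I => pd s (g^~ I) x) J +
     \sum_I g x I *
       \sum_t H r (I t) (J t) * \prod_(t' | t' != t) A (I t') (J t')).
Proof.
move=> dg.
have E I := is_deriveM_scal (is_derive_trans r cx (dg I))
  (is_derive_bigprod (fun t => is_derive_jac r (I t) (J t))).
have := is_derive_bigsum (index_enum _) xpredT E.
congr is_derive; rewrite big_split /=; congr (_ + _); rewrite /pullback.
under [RHS]eq_bigr do rewrite mulr_sumr.
rewrite exchange_big; apply: eq_bigr => I _; rewrite mulr_suml.
by apply: eq_bigr => s _; rewrite mulrA.
Qed.

End ChartDerivatives.

(** * Forms and their linearizations *)

Lemma is_derive_dx_wedge (R : realType) (V : normedModType R) n k
    (th : 'I_n -> {ffun 'I_k -> 'I_n} -> V -> R) dth x v J :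
  (forall r I, is_derive x v (th r I) (dth r I)) ->
  is_derive x v (fun y => dx_wedge (fun r I => th r I y) J) (dx_wedge dth J).
Proof.
move=> dthE; pose c (a : R) : is_derive x v (fun=> a) 0 := is_derive_cst a x v.
have S p := is_deriveM_scal (c ((-1) ^+ (p : 'S_k.+1)))
  (dthE (J (p ord0)) [ffun t => J (p (lift ord0 t))]).
have := is_deriveM_scal (c (k`!%:R)^-1)
  (is_derive_bigsum (index_enum _) xpredT S).
congr is_derive; rewrite mul0r add0r; congr (_ * _); apply: eq_bigr => p _.
by rewrite mul0r add0r.
Qed.

Section Forms.
Context {R : realType} {n : nat} {M : topologicalType} (X : manifold R n M).
Implicit Types c d : chart X.
Local Notation mindex k := {ffun 'I_k -> 'I_n}.

Lemma open_cod_setX c d : open (cod c `*` cod d).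
Proof. by apply: open_setX; exact: cod_open. Qed.

Lemma near_overlap c c' x (P : 'rV[R]_n -> Prop) : overlap c c' x ->
  (forall u, overlap c c' u -> P u) -> \forall u \near x, P u.
Proof.
move=> cx HP.
by apply: filterS HP (open_nbhs_nbhs (conj (@open_overlap _ _ _ X c c') cx)).
Qed.

(** Transformation laws hold on overlaps only; as these are open, the laws may still be
    differentiated. *)
Lemma is_derive_near c c' x v (f g : 'rV[R]_n -> R) (l : R) : overlap c c' x ->
  (forall u, overlap c c' u -> g u = f u) ->
  is_derive x v f l -> 'D_v g x = l.
Proof.
move=> cx gf [_ <-]; apply: near_eq_derive; exact: near_overlap cx gf.
Qed.

Section HForm.
Variables (k : nat) (w : hcomp X k).
Hypothesis hw : hforms w.

Lemma hform_differentiable c d I x y : cod c x -> cod d y ->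
  differentiable (fun z : 'rV[R]_n * 'rV[R]_n => w c d z.1 z.2 I) (x, y).
Proof.
by move=> cx cy; exact: (smooth_differentiable (hform_smooth hw c d I)).
Qed.

Lemma hform_differentiable_fst c d I x y : cod c x -> cod d y ->
  differentiable (fun u => w c d u y I) x.
Proof.
by move=> cx cy; exact: (differentiable_fst (hform_differentiable I cx cy)).
Qed.

Lemma hform_differentiable_snd c d I x y : cod c x -> cod d y ->
  differentiable (fun v => w c d x v I) y.
Proof.
by move=> cx cy; exact: (differentiable_snd (hform_differentiable I cx cy)).
Qed.

Lemma hform_pd_snd c c' d d' x' y' a J : overlap c' c x' -> overlap d' d y' ->
  let x := trans c' c x' in let y := trans d' d y' in
  pd a (fun v => w c' d' x' v J) y' =
  \sum_m jac (trans d' d) y' m a *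
    pullback (jac (trans c' c) x') (fun I => pd m (fun v => w c d x v I) y) J.
Proof.
move=> cx cy x y.
have dg I : differentiable (fun v => w c d x v I) y.
  apply: hform_differentiable_snd; exact: overlap_cod (trans_overlap _).
apply: is_derive_near cy _
  (is_derive_pullback_trans cy (jac (trans c' c) x') a J dg).
by move=> v cv; rewrite (hform_change hw J cx cv).
Qed.

(** Each clause comes from the matching clause for [w] by differentiation in the second argument. On
    the diagonal both arguments change by the same transition map, so the new index [a] transforms
    by the same Jacobian as the form indices. *)
Lemma tforms_lin : tforms (lin w).
Proof.
split.
- move=> c x a cx s I.
  have dw : is_derive x (delta_mx ord0 a) (fun y => (-1) ^+ s * w c c x y I)
      (0 * w c c x x I + (-1) ^+ s * lin w c x a I).
    apply: is_deriveM_scal (is_derive_cst _ _ _) _.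
    apply: derivableP; apply: diff_derivable.
    exact: hform_differentiable_snd.
  rewrite mul0r add0r in dw; apply: is_derive_near (overlap_refl cx) _ dw.
  by move=> y /overlap_cod cy; exact: hform_alt.
- by move=> c a I; exact: (smooth_pd_diag a (hform_smooth hw c c I)).
- move=> c c' x' a J cx; rewrite [LHS](hform_pd_snd a J cx cx).
  apply: eq_bigr => b _; rewrite /pullback mulr_sumr; apply: eq_bigr => I _.
  by rewrite mulrA [jac _ _ _ _ * _]mulrC.
Qed.

End HForm.

Variable eps : ecomp X.
Hypothesis heps : is_splitting eps.

(** By [eps_comp] this matrix is idempotent, and an invertible idempotent is the identity. *)
Lemma eps_diag c x : cod c x -> eps c c x x = 1%:M.
Proof.
move=> cx; have U := eps_unit heps cx cx.
by rewrite -(mulKmx U (eps c c x x)) (eps_comp heps cx cx cx) mulVmx.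
Qed.

Lemma eps_diag_sum c x (P Q : 'I_n -> R) r : cod c x ->
  \sum_b (P b * eps c c x x b r + Q b) = P r + \sum_b Q b.
Proof.
move=> cx; rewrite big_split eps_diag //; congr (_ + _).
rewrite (bigD1 r) //= big1 ?addr0 => [|b br]; first by rewrite mxE eqxx mulr1.
by rewrite mxE (negbTE br) mulr0.
Qed.

(** The transformation law with the Jacobian of the second argument moved to the left, which avoids
    differentiating an inverse. *)
Lemma eps_intertwine c c' d d' x' y' : overlap c' c x' -> overlap d' d y' ->
  jac (trans d' d) y' *m eps c' d' x' y' =
  eps c d (trans c' c x') (trans d' d y') *m jac (trans c' c) x'.
Proof.
move=> cx cy; rewrite (eps_change heps cx cy) !mulmxA.
have := jacK (trans_overlap cy); rewrite transK // => ->.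
by rewrite mul1mx.
Qed.

Lemma eps_differentiable c d x y a r : cod c x -> cod d y ->
  differentiable (fun z : 'rV[R]_n * 'rV[R]_n => eps c d z.1 z.2 a r) (x, y).
Proof.
by move=> cx cy; exact: (smooth_differentiable (eps_smooth heps c d a r)).
Qed.

Lemma eps_differentiable_snd c d x y a r : cod c x -> cod d y ->
  differentiable (fun v => eps c d x v a r) y.
Proof.
by move=> cx cy; exact: (differentiable_snd (eps_differentiable a r cx cy)).
Qed.

Lemma eps_is_derive_snd c d x y a r m : cod c x -> cod d y ->
  is_derive y (delta_mx ord0 m) (fun v => eps c d x v a r)
    (pd m (fun v => eps c d x v a r) y).
Proof.
move=> cx cy; apply: derivableP; apply: diff_derivable.
exact: eps_differentiable_snd.
Qed.

Lemma hforms_dtilde k (w : hcomp X k) : hforms w -> hforms (dtilde eps w).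
Proof.
move=> hw; split.
- by move=> c d x y _ _; exact: alternating_dx_wedge.
- move=> c d J; apply: smooth_dx_wedge (@open_cod_setX c d) _ => r I.
  have Fs := hform_smooth hw c d I.
  apply: smoothD; first exact: open_cod_setX.
    apply: (@smooth_eq _ _ _ (@open_cod_setX c d) _ _ _ _
      (smooth_derive (delta_mx ord0 r, 0) Fs)).
    by move=> [x y] _; rewrite -(pd_fst (fun z => w c d z.1 z.2 I)).
  apply: smooth_sum; first exact: open_cod_setX.
  move=> a _; apply: smoothM; first exact: open_cod_setX.
    apply: (@smooth_eq _ _ _ (@open_cod_setX c d) _ _ _ _
      (smooth_derive (0, delta_mx ord0 a) Fs)).
    by move=> [x y] _; rewrite -(pd_snd (fun z => w c d z.1 z.2 I)).
  exact: (eps_smooth heps).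
move=> c c' d d' x' y' J cx cy.
set x := trans c' c x'; set y := trans d' d y'.
have cx0 : cod c x by exact: overlap_cod (trans_overlap cx).
have cy0 : cod d y by exact: overlap_cod (trans_overlap cy).
pose A := jac (trans c' c) x'.
pose H r := \matrix_(i, j) pd r (fun u => jac (trans c' c) u i j) x'.
pose th r I := pd r (fun u => w c d u y I) x +
  \sum_a pd a (fun v => w c d x v I) y * eps c d x y a r.
(* Before antisymmetrization the components are tensorial except for a Hessian term, produced by
   differentiating the Jacobians of the form indices. *)
transitivity (dx_wedge (fun r I => (\sum_s A s r * pullback A (th s) I) +
  \sum_K w c d x y K *
    \sum_t H r (K t) (I t) * \prod_(t' | t' != t) A (K t') (I t')) J).
  apply: eq_dx_wedge => r I.
  have dg K : differentiable (fun u => w c d u y K) x.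
    exact: hform_differentiable_fst.
  have wE u (cu : overlap c' c u) := hform_change hw I cu cy.
  have pdE : pd r (fun u => w c' d' u y' I) x' = _ :=
    is_derive_near cx wE (is_derive_pullback cx r I dg).
  rewrite pdE addrAC; congr (_ + _).
  under [X in _ + X]eq_bigr => a _ do
    rewrite (hform_pd_snd hw a I cx cy) -/x -/y -/A.
  rewrite /th.
  under [RHS]eq_bigr => s _ do rewrite pullbackD mulrDr.
  rewrite big_split /=; congr (_ + _).
  under eq_bigr do rewrite mulr_suml.
  rewrite exchange_big /=.
  under [RHS]eq_bigr => s _ do rewrite pullback_sum mulr_sumr.
  rewrite [RHS]exchange_big /=; apply: eq_bigr => m _.
  (* Carried across [eps], the Jacobian at [y'] becomes the Jacobian at [x']; this makes the index
     [r] transform as a covector index at [x']. *)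
  have /matrixP /(_ m r) := eps_intertwine cx cy; rewrite !mxE -/x -/y -/A => E.
  under eq_bigr do rewrite mulrAC.
  rewrite -mulr_suml E mulr_suml; apply: eq_bigr => s _.
  ring.
rewrite dx_wedgeD dx_wedge_pullback dx_wedge_hessian ?addr0 //.
move=> r i j; exact: (hessian_sym cx).
Qed.

Lemma smooth_GammaH c b r a : smooth (cod c) (fun x => GammaH eps c x b r a).
Proof. exact: (smooth_pd_diag a (eps_smooth heps c c b r)). Qed.

(** Differentiate [eps_intertwine] in its second argument along the direction [a], with the first
    held at [x']. On the left the Jacobian also varies; as [eps] is the identity on the diagonal,
    its derivative contributes exactly one Hessian entry. *)
Lemma GammaH_change c c' x' m r a : overlap c' c x' ->
  let x := trans c' c x' in let A := jac (trans c' c) x' in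
  \sum_b A m b * GammaH eps c' x' b r a =
  \sum_j (\sum_l A l a * GammaH eps c x m j l) * A j r
  - pd a (fun u => jac (trans c' c) u m r) x'.
Proof.
move=> cx x A.
have c'x : cod c' x' by exact: overlap_cod cx.
have cx0 : cod c x by exact: overlap_cod (trans_overlap cx).
have DL b := is_deriveM_scal (is_derive_jac cx a m b)
  (eps_is_derive_snd b r a c'x c'x).
have DR j := is_deriveM_scal
  (is_derive_trans a cx (eps_differentiable_snd m j cx0 cx0))
  (is_derive_cst (A j r) x' (delta_mx ord0 a)).
have {}DL := is_derive_bigsum (index_enum _) xpredT DL.
have {}DR := is_derive_bigsum (index_enum _) xpredT DR.
have LR u : overlap c' c u ->
    \sum_b jac (trans c' c) u m b * eps c' c' x' u b r =
    \sum_j eps c c x (trans c' c u) m j * A j r.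
  by move=> cu; have /matrixP /(_ m r) := eps_intertwine cx cu; rewrite !mxE.
have := is_derive_near cx LR DR; case: DL => _ ->; rewrite big_split /=.
under [RHS]eq_bigr do rewrite mulr0 addr0.
rewrite addrC => /(canRL (addrK _)) E; apply: etrans E _; congr (_ - _).
rewrite (bigD1 r) //= big1 ?addr0 => [|b br].
  by rewrite eps_diag // [1%:M _ _]mxE eqxx mulr1; exact: hessianE.
by rewrite eps_diag // !mxE (negbTE br) mulr0.
Qed.

Lemma tforms_dhat k (s : tcomp X k) : tforms s -> tforms (dhat eps s).
Proof.
move=> hs; split.
- by move=> c x a _; exact: alternating_dx_wedge.
- move=> c a J; apply: smooth_dx_wedge (@cod_open _ _ _ X c) _ => r I.
  apply: smoothD; first exact: cod_open.
    by apply: smooth_derive; exact: (tform_smooth hs).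
  apply: smooth_sum => [|b _]; first exact: cod_open.
  apply: smoothM; first exact: cod_open.
    exact: (tform_smooth hs).
  exact: smooth_GammaH.
move=> c c' x' a J cx; set x := trans c' c x'.
have cx0 : cod c x by exact: overlap_cod (trans_overlap cx).
pose A := jac (trans c' c) x'.
pose H r := \matrix_(i, j) pd r (fun u => jac (trans c' c) u i j) x'.
pose th m r I := pd r (fun u => s c u m I) x +
  \sum_b s c x b I * GammaH eps c x b r m.
pose hess m r I := \sum_K s c x m K *
    \sum_t H r (K t) (I t) * \prod_(t' | t' != t) A (K t') (I t').
have sE b u K : overlap c' c u -> s c' u b K =
    \sum_m pullback (jac (trans c' c) u) (s c (trans c' c u) m) K *
           jac (trans c' c) u m b.
  move=> cu; rewrite (tform_change hs b K cu); apply: eq_bigr => m _.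
  by rewrite /pullback mulr_suml; apply: eq_bigr => I _; rewrite mulrAC.
(* The target keeps only the Hessian term of the form indices; the one of the covector index [a],
   which is not antisymmetrized, has to cancel first. *)
transitivity (dx_wedge (fun r I => (\sum_m A m a *
  (\sum_s A s r * pullback A (th m s) I)) + \sum_m A m a * hess m r I) J).
  apply: eq_dx_wedge => r I.
  have dg m K : differentiable (fun u => s c u m K) x.
    exact: smooth_differentiable (tform_smooth hs c m K) cx0.
  have D m := is_deriveM_scal (is_derive_pullback cx r I (dg m))
    (is_derive_jac cx r m a).
  have {}D := is_derive_bigsum (index_enum _) xpredT D.
  have pdE : pd r (fun u => s c' u a I) x' = _ :=
    is_derive_near cx (fun u => @sE a u I) D.
  rewrite pdE {pdE D}.
  have GE : \sum_b s c' x' b I * GammaH eps c' x' b r a =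
      \sum_m pullback A (s c x m) I *
        (\sum_j (\sum_l A l a * GammaH eps c x m j l) * A j r - H a m r).
    under eq_bigr => b _ do rewrite (sE b x' I cx) mulr_suml.
    rewrite exchange_big /=; apply: eq_bigr => m _.
    under eq_bigr do rewrite -mulrA.
    rewrite -mulr_sumr (GammaH_change m r a cx); congr (_ * (_ - _)).
    exact/esym/hessianE.
  rewrite GE {GE} -!big_split /=.
  pose P m := pullback A (s c x m) I.
  pose Q m t := pullback A (fun K => pd t (fun u => s c u m K) x) I.
  have thE m t : pullback A (th m t) I =
      Q m t + \sum_b P b * GammaH eps c x b t m.
    by rewrite pullbackD pullback_sum.
  under [RHS]eq_bigr => m _ do under eq_bigr => t _ do rewrite thE mulrDr.
  under [RHS]eq_bigr => m _ do rewrite big_split /= -/A mulrDr addrAC -mulrDr.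
  rewrite [RHS]big_split /=.
  (* Both sides are the same triple contraction with [GammaH], with the summation indices renamed
     and reordered. *)
  have -> : \sum_m A m a * \sum_t A t r * \sum_b P b * GammaH eps c x b t m =
      \sum_m P m * \sum_j (\sum_l A l a * GammaH eps c x m j l) * A j r.
    under eq_bigr do rewrite mulr_sumr.
    under eq_bigr do under eq_bigr do rewrite !mulr_sumr.
    under [RHS]eq_bigr do rewrite mulr_sumr.
    under [RHS]eq_bigr do under eq_bigr do rewrite mulr_suml mulr_sumr.
    rewrite [RHS]exchange_big [LHS]exchange_big; apply: eq_bigr => t _ /=.
    rewrite [RHS]exchange_big; apply: eq_bigr => m _ /=.
    by apply: eq_bigr => b _; ring.
  rewrite -big_split /=; apply: eq_bigr => m _.
  (* The first entry comes from differentiating the Jacobian of the covector index, the second from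
     the inhomogeneous term of [GammaH_change]; symmetry makes them cancel. *)
  have HE : H r m a = H a m r := hessian_sym cx r m a.
  have cancel (S h al p h1 h2 G : R) : h1 = h2 ->
      (S + h) * al + p * h1 + p * (G - h2) = al * (S + h) + p * G.
    by move=> ->; ring.
  exact: cancel HE.
rewrite dx_wedgeD !dx_wedge_sum [X in _ + X]big1 ?addr0 => [|m _]; last first.
  rewrite dx_wedge_hessian ?mulr0 // => r i j; exact: (hessian_sym cx).
apply: eq_bigr => m _; rewrite dx_wedge_pullback /pullback mulr_sumr.
by apply: eq_bigr => I _; rewrite mulrA [A m a * _]mulrC.
Qed.

(** Differentiating a component of [dtilde] in [y] at [y = x] gives a mixed second derivative, a
    second derivative in [y] contracted with [eps], and the [GammaH] term. For [dhat] of [lin], the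
    first two arise together as a derivative along the diagonal. *)
Lemma lin_dtilde k (w : hcomp X k) : hforms w ->
  tform_eq (lin (dtilde eps w)) (dhat eps (lin w)).
Proof.
move=> hw c x a J cx; rewrite /lin.
pose F I (z : 'rV[R]_n * 'rV[R]_n) := w c c z.1 z.2 I.
have Fs I : smooth (cod c `*` cod c) (F I) := hform_smooth hw c c I.
have oU := @open_cod_setX c c.
have xx : (cod c `*` cod c) (x, x) by [].
pose D r I y := 'D_(delta_mx ord0 r, 0) (F I) (x, y) +
  \sum_(b < n) 'D_(0, delta_mx ord0 b) (F I) (x, y) * eps c c x y b r.
have DE : (fun y => dtilde eps w c c x y J) =
    fun y => dx_wedge (fun r I => D r I y) J.
  apply/funext => y; apply: eq_dx_wedge => r I; rewrite /D -(pd_fst (F I)).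
  by congr (_ + _); apply: eq_bigr => b _; rewrite -(pd_snd (F I)).
have dD r I : is_derive x (delta_mx ord0 a) (D r I)
   ('D_(0, delta_mx ord0 a) ('D_(delta_mx ord0 r, 0) (F I)) (x, x) +
    \sum_b ('D_(0, delta_mx ord0 a) ('D_(0, delta_mx ord0 b) (F I)) (x, x) *
      eps c c x x b r +
      'D_(0, delta_mx ord0 b) (F I) (x, x) * GammaH eps c x b r a)).
  have pdd v : is_derive x (delta_mx ord0 a) (fun y => 'D_v (F I) (x, y))
      ('D_(0, delta_mx ord0 a) ('D_v (F I)) (x, x)).
    rewrite -(pd_snd ('D_v (F I))); apply: derivableP; apply: diff_derivable.
    have dF := smooth_differentiable (smooth_derive v (Fs I)) xx.
    exact: (differentiable_snd dF).
  apply: is_deriveD (pdd _) _; apply: is_derive_bigsum => b.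
  exact: is_deriveM_scal (pdd _) (eps_is_derive_snd b r a cx cx).
rewrite DE /pd; have [_ ->] := is_derive_dx_wedge J dD.
apply: eq_dx_wedge => r I.
(* On the diagonal [eps] is the identity, so the contracted second derivative reduces to its term
   [b = r]. *)
apply: etrans (congr1 (GRing.add _) (eps_diag_sum _ _ r cx)) _.
apply: etrans (addrA _ _ _) _; apply: (congr2 (fun s t => s + t)); last first.
  by apply: eq_bigr => b _; rewrite -(pd_snd (F I)).
have dE : (fun u => pd a (fun y => w c c u y I) u) =
    fun u => 'D_(0, delta_mx ord0 a) (F I) (diag u).
  by apply/funext => u; rewrite (pd_snd (F I)).
rewrite /lin dE.
(* Moving a point of the diagonal in direction [r] moves both arguments at once. *)
have -> : pd r (fun u => 'D_(0, delta_mx ord0 a) (F I) (diag u)) x =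
    'D_(delta_mx ord0 r, delta_mx ord0 r)
      ('D_(0, delta_mx ord0 a) (F I)) (x, x).
  by apply: (@derive_along _ _ _ _ _ diag) => h.
have dF : differentiable ('D_(0, delta_mx ord0 a) (F I)) (x, x).
  exact: (smooth_differentiable (smooth_derive _ (Fs I)) xx).
have S v w := derive_swap v w oU (Fs I 2) xx.
rewrite (S (delta_mx ord0 r, 0) (0, delta_mx ord0 a)).
rewrite (S (0, delta_mx ord0 r) (0, delta_mx ord0 a)).
(* Once the order of differentiation is exchanged, the claim is linearity of the differential on the
   sum of the horizontal and vertical vectors of index [r]. *)
rewrite !deriveE // -linearD; congr ('d _ _ _).
by congr pair; rewrite /= ?addr0 ?add0r.
Qed.

End Forms.

(** Since forms are families of components, the arrows of the diagram exist only if the operators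
    preserve smoothness, alternation and the transformation laws; the [set_fun] clauses express
    this. *)
Theorem proposition19 (R : realType) (n : nat) (M : topologicalType)
    (X : manifold R n M) (hM : connected [set: M])
    (eps : ecomp X) (heps : local_Lie_group eps) :
  (forall k : nat, (k <= n)%N ->
     set_fun (@hforms _ _ _ X k) (@tforms _ _ _ X k) (@lin _ _ _ X k)) /\
  (forall k : nat, (k < n)%N ->
     [/\ set_fun (@hforms _ _ _ X k) (@hforms _ _ _ X k.+1)
           (@dtilde _ _ _ X eps k),
         set_fun (@tforms _ _ _ X k) (@tforms _ _ _ X k.+1)
           (@dhat _ _ _ X eps k)
       & forall w : hcomp X k, hforms w ->
           tform_eq (lin (dtilde eps w)) (dhat eps (lin w))]).
Proof.
have hs := llg_splitting heps.
split=> [k _ w hw|k _]; first exact: tforms_lin.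
split=> [w hw|s' hs'|w hw].
- exact: hforms_dtilde.
- exact: tforms_dhat.
- exact: lin_dtilde.
Qed.
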